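(* Let $\mathbb{H}$ be a complex Hilbert space and let $T\in B(\mathbb{H})$. Then $$w^2(T)\le\frac12\|T\|\,\|T^2\|^{\frac12}+\frac14\|T^2\|+\frac14\|T\|^2.$$
   Context: $B(\mathbb{H})$ is the set of bounded linear operators on $\mathbb{H}$, and $\|\cdot\|$ is the operator norm. The numerical radius of $T\in B(\mathbb{H})$ is $w(T)=\sup\{|\langle Tx,x\rangle| : x\in\mathbb{H},\ \|x\|=1\}$, and $w^2(T)$ means $(w(T))^2$. *)

(* Defs.v *)
From mathcomp Require Import all_boot all_order all_algebra complex.
From mathcomp Require Import all_classical all_reals all_analysis.
Import Order.TTheory GRing.Theory Num.Theory.
Import numFieldNormedType.Exports.

Set Implicit Arguments.
Unset Strict Implicit.
Unset Printing Implicit Defensive.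

Local Open Scope classical_set_scope.
Local Open Scope ring_scope.
Local Open Scope complex_scope.

(* [{dot H for Num.conj}] is a positive definite Hermitian form, linear in its
   first argument; [inner_norm] says that the (complete) norm of [H] is the one
   induced by the inner product. *)
Record hilbertType (R : realType) := Hilbert {
  hilbert_space :> completeNormedModType R[i];
  inner : {dot hilbert_space for Num.conj};
  inner_norm : forall x : hilbert_space, inner x x = `|x| ^+ 2
}.

(* The norm of a vector and the modulus of a scalar are elements of [R[i]] (with
   zero imaginary part), hence [complex.Re] to take suprema in [R].  Also,
   [sup set0 = 0], so both quantities below vanish on the zero space. *)

Section BoundedOperators.
Variables (R : realType) (H : hilbertType R).
Implicit Type T : H -> H.

Definition bounded_operator T : Prop :=
  exists M : R, forall x : H, `|T x| <= M%:C * `|x|.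

Definition opnorm T : R :=
  sup [set complex.Re `|T x| | x in [set x : H | `|x| <= 1]].

Definition numerical_radius T : R :=
  sup [set complex.Re `|inner H (T x) x| | x in [set x : H | `|x| = 1]].

End BoundedOperators.

(* Main.v *)
Require Import Defs.
From mathcomp Require Import all_boot all_order all_algebra complex.
From mathcomp Require Import all_classical all_reals all_analysis.
From mathcomp Require Import ring lra.
Import Order.TTheory GRing.Theory Num.Theory.

(** Write [a] for the norm of [T] and [b] for the square root of the norm of
    [T^2]. The right-hand side is [((a + b) / 2)^2], so the claim is
    [lam <= a + b], where [lam] is twice the numerical radius.

    After multiplying [T] by a unimodular scalar, there are unit vectors [x]
    with [2 Re <T x, x>] close to [lam], and [lam] is an upper bound of the form
    [2 Re <T y, y>] on the unit sphere. With [S] the adjoint of [T], such [x]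
    are approximate eigenvectors of [T + S] for [lam]
    ([weak_eigenvector_of_near_maximizer]). Suppose for simplicity
    [T x + S x = lam x], and put [v = S x]. Applying [T] and then [S] to this
    equation gives [lam^2 v = S T v + lam S^2 x + S T^2 x]: every term on the
    right but the first one contains a square, so
    [(lam^2 - a^2) |v| <= (lam + a) b^2], that is [(lam - a) |v| <= b^2]. The
    same bound for [T x] follows, and [lam = |T x + v|] then yields
    [lam (lam - a) <= 2 b^2]
    ([approx_eigenvalue_le], [double_numerical_radius_quadratic]). Since
    [b <= a], this forces [lam <= a + b] ([double_numerical_radius_le]).

    The adjoint only occurs through inner products, where [<S x, y>] is
    [<x, T y>], and the whole argument takes place in the real inner product
    space with product [Re <x, y>]. *)

Set Implicit Arguments.
Unset Strict Implicit.

Local Open Scope ring_scope.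
Local Open Scope complex_scope.

(** * Cauchy-Schwarz for semidefinite real forms *)

Lemma sqr_form_le (R : realFieldType) (p q r : R) :
  (forall s t, 0 <= s ^+ 2 * p + 2 * s * t * q + t ^+ 2 * r) ->
  q ^+ 2 <= p * r.
Proof.
move=> form_ge0.
have p_ge0 : 0 <= p by have := form_ge0 1 0; lra.
have [p_gt0|] := ltP 0 p.
  have := form_ge0 (- q) p.
  have -> : (- q) ^+ 2 * p + 2 * - q * p * q + p ^+ 2 * r =
    p * (p * r - q ^+ 2) by ring.
  by rewrite pmulr_rge0 // subr_ge0.
move=> p_le0; have p0 : p = 0 by apply/eqP; rewrite eq_le p_le0.
have [->|q_neq0] := eqVneq q 0; first by rewrite p0 expr0n mul0r.
(* With [p = 0] the form is affine in [s]; this [s] makes it equal to [-1]. *)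
have := form_ge0 (- (r + 1) / (2 * q)) 1.
have -> : (- (r + 1) / (2 * q)) ^+ 2 * p + 2 * (- (r + 1) / (2 * q)) * 1 * q +
    1 ^+ 2 * r = -1 by rewrite p0; field.
by rewrite oppr_ge0 ler10.
Qed.

(** Stated for semidefinite forms because the form measuring how far a vector is
    from maximizing [Re <T x, x>] vanishes on the maximizers. *)
Lemma psd_form_CauchySchwarz (R : realType) (V : lmodType R[i])
    (q : V -> V -> R) (qC : forall x y, q x y = q y x)
    (qD : forall x y z, q (x + y) z = q x z + q y z)
    (qZ : forall (k : R) x y, q (k%:C *: x) y = k * q x y)
    (q_ge0 : forall x, 0 <= q x x) (x y : V) :
  q x y ^+ 2 <= q x x * q y y.
Proof.
apply: sqr_form_le => s t.
have := q_ge0 (s%:C *: x + t%:C *: y).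
rewrite qD !qZ (qC x) (qC y) !qD !qZ (qC y x); nra.
Qed.

Lemma unimodular_phase (R : realType) (z : R[i]) :
  exists2 c : R[i], `|c| = 1 & c * z = `|z|.
Proof.
have [->|z_neq0] := eqVneq z 0.
  by exists 1; rewrite ?normr1 ?normr0 ?mulr0.
exists (`|z| / z); last by rewrite divfK.
by rewrite normrM normfV normr_id divff // normr_eq0.
Qed.

(** * The real inner product space underlying a complex Hilbert space *)

Section RealStructure.
Variables (R : realType) (H : hilbertType R).
Implicit Types (x y z : H) (k : R).

Definition rnorm x : R := complex.Re `|x|.
Definition rdot x y : R := complex.Re (inner H x y).

Lemma rnormE x : `|x| = (rnorm x)%:C.
Proof. by rewrite /rnorm RRe_real // normr_real. Qed.

Lemma rnorm_ge0 x : 0 <= rnorm x.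
Proof. by rewrite -ler0c -rnormE. Qed.

Lemma rnormD x y : rnorm (x + y) <= rnorm x + rnorm y.
Proof. by have := ler_normD x y; rewrite !rnormE -rmorphD /= lecR. Qed.

Lemma rnormZ (c : R[i]) x : rnorm (c *: x) = complex.Re `|c| * rnorm x.
Proof.
have Re_normc : (complex.Re `|c|)%:C = `|c| by rewrite RRe_real // normr_real.
by apply: complexI; rewrite rmorphM /= Re_normc -!rnormE normrZ.
Qed.

Lemma rdotDl x y z : rdot (x + y) z = rdot x z + rdot y z.
Proof. by rewrite /rdot linearDl raddfD. Qed.

Lemma rdotZl k x y : rdot (k%:C *: x) y = k * rdot x y.
Proof.
rewrite /rdot linearZl_LR /=.
by case: (inner H x y) => u v /=; rewrite mul0r subr0.
Qed.

Lemma rdotC x y : rdot x y = rdot y x.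
Proof.
rewrite /rdot (hermC (inner H) x y) expr0 mul1r /=.
by apply: complexI; rewrite !complexRe Re_conj.
Qed.

Lemma rdotxx x : rdot x x = rnorm x ^+ 2.
Proof. by rewrite /rdot inner_norm rnormE -rmorphXn. Qed.

Lemma rdotNl x y : rdot (- x) y = - rdot x y.
Proof. by rewrite -scaleN1r -[-1](rmorphN1 (real_complex R)) rdotZl mulN1r. Qed.

Lemma rdotBl x y z : rdot (x - y) z = rdot x z - rdot y z.
Proof. by rewrite rdotDl rdotNl. Qed.

Lemma rdot_le x y : rdot x y <= rnorm x * rnorm y.
Proof.
have CS : rdot x y ^+ 2 <= rdot x x * rdot y y.
  apply: psd_form_CauchySchwarz; [exact: rdotC|exact: rdotDl|exact: rdotZl|].
  by move=> ?; rewrite rdotxx sqr_ge0.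
move: CS; rewrite !rdotxx -exprMn => CS.
apply: le_trans (ler_norm _) _.
by rewrite -ler_sqr ?nnegrE ?mulr_ge0 ?rnorm_ge0 // real_normK ?num_real.
Qed.

(** * Approximate eigenvectors of twice the real part *)

(** The last hypothesis says that [T x + S x] is within [eta] of [lam x] for
    the adjoint [S] of [T], with [v := lam x - T x] in the role of [S x].
    Suppose [eta = 0]. From [T v = lam T x - T^2 x] and [<v, y> = <x, T y>] for
    [y = v] and [y = T v],
    [lam^2 |v|^2 = |T v|^2 + <T^2 x, T v> + lam <x, T^2 v>], which is at most
    [a^2 |v|^2 + (a + lam) s |v|]; as [lam^2 - a^2] factors,
    [(lam - a) |v| <= s]. Also [lam |T x| = |T v + T^2 x| <= a |v| + s], and
    [lam = |T x + v| <= |T x| + |v|]. Eliminating [|v|] and [|T x|] yields the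
    claim, and a positive [eta] perturbs each step linearly. *)
Lemma approx_eigenvalue_le (T : {linear H -> H}) (a s lam eta : R) x :
  0 <= a -> 0 <= s -> 0 <= eta -> a < lam -> rnorm x = 1 ->
  (forall y, rnorm (T y) <= a * rnorm y) ->
  (forall y, rnorm (T (T y)) <= s * rnorm y) ->
  (forall y, rdot (lam%:C *: x - T x) y - rdot x (T y) <= eta * rnorm y) ->
  lam * (lam - a) <= 2 * s + (lam + a) * eta.
Proof.
move=> a_ge0 s_ge0 eta_ge0 a_lt x1 Ta TTs weak.
set v := lam%:C *: x - T x in weak.
have lam_gt0 : 0 < lam by lra.
have Tv : T v = lam%:C *: T x - T (T x) by rewrite /v linearB linearZ.
have v_ge0 := rnorm_ge0 v.
have v_le : (lam - a) * rnorm v <= s + lam * eta.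
  have key : lam ^+ 2 * rdot v v = rdot (T v) (T v) + rdot (T (T x)) (T v)
      + lam * rdot x (T (T v))
      + lam * (rdot v (T v) - rdot x (T (T v)))
      + lam ^+ 2 * (rdot v v - rdot x (T v)).
    have -> : rdot (T v) (T v) = lam * rdot (T x) (T v) - rdot (T (T x)) (T v).
      by rewrite {1}Tv rdotBl rdotZl.
    have -> : rdot v (T v) = lam * rdot x (T v) - rdot (T x) (T v).
      by rewrite {1}/v rdotBl rdotZl.
    ring.
  have b1 := Ta v.
  have b2 : rdot (T (T x)) (T v) <= s * (a * rnorm v).
    apply: le_trans (rdot_le _ _) _; apply: ler_pM; rewrite ?rnorm_ge0 //.
    by have := TTs x; rewrite x1 mulr1.
  have b3 : rdot x (T (T v)) <= s * rnorm v.
    by apply: le_trans (rdot_le _ _) _; rewrite x1 mul1r TTs.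
  have b4 : rdot v (T v) - rdot x (T (T v)) <= eta * (a * rnorm v).
    by apply: le_trans (weak _) _; rewrite ler_wpM2l.
  have b5 := weak v.
  have b6 : rdot (T v) (T v) <= (a * rnorm v) ^+ 2.
    by rewrite rdotxx lerXn2r ?nnegrE ?rnorm_ge0 ?mulr_ge0.
  have [v0|v_neq0] := eqVneq (rnorm v) 0; first by rewrite v0 mulr0; nra.
  have v_gt0 : 0 < rnorm v by rewrite lt_def v_neq0.
  rewrite -(ler_pM2r (_ : 0 < (lam + a) * rnorm v)); last first.
    by rewrite mulr_gt0 //; lra.
  rewrite !(rdotxx v) in key b5.
  have c3 := ler_wpM2l (ltW lam_gt0) b3.
  have c4 := ler_wpM2l (ltW lam_gt0) b4.
  have c5 := ler_wpM2l (sqr_ge0 lam) b5.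
  lra.
have u_le : lam * rnorm (T x) <= a * rnorm v + s.
  have -> : lam * rnorm (T x) = rnorm (lam%:C *: T x).
    by rewrite rnormZ normc_def /= expr0n addr0 sqrtr_sqr gtr0_norm.
  have -> : lam%:C *: T x = T v + T (T x) by rewrite Tv subrK.
  apply: le_trans (rnormD _ _) _; apply: lerD => //.
  by have := TTs x; rewrite x1 mulr1.
have lam_le : lam <= rnorm (T x) + rnorm v.
  have -> : lam = rnorm (T x + v).
    rewrite /v addrC subrK rnormZ x1 normc_def /= expr0n addr0 sqrtr_sqr.
    by rewrite gtr0_norm ?mulr1.
  exact: rnormD.
rewrite -(ler_pM2l lam_gt0).
have gap_ge0 : 0 <= lam - a by lra.
have sum_ge0 : 0 <= lam + a by lra.
have := ler_wpM2l (mulr_ge0 gap_ge0 (ltW lam_gt0)) lam_le.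
have := ler_wpM2l gap_ge0 u_le.
have := ler_wpM2l sum_ge0 v_le.
lra.
Qed.

(** The numerical radius makes [q y z := lam <y, z> - <T y, z> - <y, T z>]
    positive semidefinite, and a near maximizer [x] of [<T x, x>] makes [q x x]
    small; Cauchy-Schwarz for [q] then makes [q x y] small for every [y]. *)
Lemma weak_eigenvector_of_near_maximizer (T : {linear H -> H}) (lam eta : R) x :
  0 < lam ->
  (forall y, `|2 * rdot (T y) y| <= lam * rnorm y ^+ 2) -> 0 <= eta ->
  2 * lam * (lam * rnorm x ^+ 2 - 2 * rdot (T x) x) <= eta ^+ 2 ->
  forall y, rdot (lam%:C *: x - T x) y - rdot x (T y) <= eta * rnorm y.
Proof.
move=> lam_gt0 Tle eta_ge0 xnear y.
pose q y z := lam * rdot y z - rdot (T y) z - rdot y (T z).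
have qxx z : q z z = lam * rnorm z ^+ 2 - 2 * rdot (T z) z.
  by rewrite /q rdotxx (rdotC z (T z)); ring.
have CS : q x y ^+ 2 <= q x x * q y y.
  apply: psd_form_CauchySchwarz.
  - move=> u z; rewrite /q (rdotC z u) (rdotC (T z) u) (rdotC z (T u)); ring.
  - by move=> *; rewrite /q linearD !rdotDl; ring.
  - by move=> *; rewrite /q linearZ !rdotZl; ring.
  - by move=> z; rewrite qxx; have := Tle z; rewrite ler_norml; lra.
have -> : rdot (lam%:C *: x - T x) y - rdot x (T y) = q x y.
  by rewrite rdotBl rdotZl.
apply: le_trans (ler_norm _) _.
rewrite -ler_sqr ?nnegrE ?mulr_ge0 ?rnorm_ge0 // real_normK ?num_real //.
have qyy : q y y <= 2 * lam * rnorm y ^+ 2.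
  by rewrite qxx; have := Tle y; rewrite ler_norml; lra.
apply: le_trans CS _; rewrite exprMn -qxx in xnear *.
have qx_ge0 : 0 <= q x x.
  by rewrite qxx; have := Tle x; rewrite ler_norml; lra.
apply: le_trans (ler_wpM2l qx_ge0 qyy) _.
have := ler_wpM2r (sqr_ge0 (rnorm y)) xnear; lra.
Qed.

End RealStructure.

(** * Bounds by the operator norm and the numerical radius *)

Section OperatorBounds.
Variables (R : realType) (H : hilbertType R) (T : {linear H -> H}).
Hypothesis hT : bounded_operator T.

Lemma opnorm_ubound (x : H) : `|x| <= 1 -> rnorm (T x) <= opnorm T.
Proof.
move=> x1; apply: ub_le_sup; last by exists x.
have [M TM] := hT; exists (Num.max 0 M) => _ [y /= y1 <-].
have := TM y; rewrite !rnormE -rmorphM /= lecR -/(rnorm _) => /le_trans; apply.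
move: y1; rewrite rnormE (_ : 1 = (1 : R)%:C) // lecR => y1.
have := rnorm_ge0 y; rewrite le_max => y_ge0.
have [M_ge0|M_lt0] := leP 0 M; apply/orP; [right|left]; nra.
Qed.

Lemma opnorm_ge0 : 0 <= opnorm T.
Proof.
apply: le_trans (rnorm_ge0 (T 0)) _.
by rewrite opnorm_ubound ?normr0 ?ler01.
Qed.

Lemma rnorm_le_opnorm (x : H) : rnorm (T x) <= opnorm T * rnorm x.
Proof.
have [->|x_neq0] := eqVneq x 0.
  by rewrite linear0 /rnorm normr0 /= mulr0.
have x_gt0 : 0 < rnorm x by rewrite -ltcR -rnormE normr_gt0.
have := @opnorm_ubound (`|x|^-1 *: x).
rewrite normrZ normfV normr_id mulVf ?normr_eq0 // linearZ => /(_ (lexx _)).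
rewrite /= rnormZ normfV normr_id rnormE -fmorphV /= ler_pdivrMl // mulrC.
by [].
Qed.

Lemma modulus_inner_le (x y : H) :
  complex.Re `|inner H x y| <= rnorm x * rnorm y.
Proof.
have [c c1 cz] := unimodular_phase (inner H x y).
have := rdot_le (c *: x) y.
by rewrite rnormZ c1 /= mul1r /rdot linearZl_LR /= cz.
Qed.

Lemma numerical_radius_has_ubound :
  has_ubound [set complex.Re `|inner H (T x) x| | x in [set x : H | `|x| = 1]].
Proof.
exists (opnorm T) => _ [x /= x1 <-]; apply: le_trans (modulus_inner_le _ _) _.
by rewrite [rnorm x]/rnorm x1 mulr1 opnorm_ubound ?x1.
Qed.

Lemma modulus_le_numerical_radius (x : H) :
  complex.Re `|inner H (T x) x| <= numerical_radius T * rnorm x ^+ 2.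
Proof.
have [->|x_neq0] := eqVneq x 0.
  by rewrite linear0r normr0 /rnorm normr0 /= expr0n mulr0.
have x_gt0 : 0 < rnorm x by rewrite -ltcR -rnormE normr_gt0.
set y := (rnorm x)^-1%:C *: x.
have y1 : `|y| = 1.
  by rewrite /y normrZ fmorphV /= -rnormE normfV normr_id mulVf ?normr_eq0.
have : complex.Re `|inner H (T y) y| <= numerical_radius T.
  by apply: ub_le_sup; [exact: numerical_radius_has_ubound|exists y].
have -> : inner H (T y) y = ((rnorm x)^-1 ^+ 2)%:C * inner H (T x) x.
  rewrite /y [T _]linearZ linearZl_LR linearZr_LR /= mulrA; congr (_ * _).
  by rewrite (conj_Creal _) ?complex_real ?eqxx // -rmorphM.
rewrite normrM normc_def /= expr0n addr0 sqrtr_sqr normrX.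
rewrite ger0_norm ?invr_ge0 ?rnorm_ge0 //.
rewrite mul0r subr0 exprVn mulrC.
by rewrite ler_pdivrMr ?exprn_gt0.
Qed.

Lemma numerical_radius_ge0 : 0 <= numerical_radius T.
Proof.
rewrite /numerical_radius; set A := (X in sup X).
have [A0|/set0P[_ [x /= x1 _]]] := eqVneq A set0; first by rewrite A0 sup0.
apply: le_trans (_ : complex.Re `|inner H (T x) x| <= _).
  by rewrite -ler0c RRe_real ?normr_real.
by apply: ub_le_sup; [exact: numerical_radius_has_ubound|exists x].
Qed.

End OperatorBounds.

Lemma bounded_operator_square (R : realType) (H : hilbertType R)
    (T : {linear H -> H}) :
  bounded_operator T -> bounded_operator (T \o T).
Proof.
move=> hT; exists (opnorm T ^+ 2) => x /=.
rewrite !rnormE -rmorphM lecR expr2 -mulrA.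
apply: le_trans (rnorm_le_opnorm hT _) _.
by rewrite ler_wpM2l ?opnorm_ge0 ?rnorm_le_opnorm.
Qed.

Lemma opnorm_square_le (R : realType) (H : hilbertType R)
    (T : {linear H -> H}) :
  bounded_operator T -> opnorm (T \o T) <= opnorm T ^+ 2.
Proof.
move=> hT; apply: ge_sup.
  by exists (rnorm (T (T 0))), 0; rewrite //= normr0 ler01.
move=> _ [x /= x1 <-]; apply: le_trans (rnorm_le_opnorm hT _) _.
by rewrite expr2 ler_wpM2l ?opnorm_ge0 ?opnorm_ubound.
Qed.

(** * The numerical radius inequality *)

(** When [|T| < 2 w(T)] this amounts to
    [4 w(T) <= |T| + sqrt (|T|^2 + 8 |T^2|)], which improves on the bound
    [w(T) <= (|T| + sqrt |T^2|) / 2]. It is the limit of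
    [approx_eigenvalue_le] along near maximizers of the numerical radius. *)
Lemma double_numerical_radius_quadratic (R : realType) (H : hilbertType R)
    (T : {linear H -> H}) (hT : bounded_operator T) :
  opnorm T < 2 * numerical_radius T ->
  2 * numerical_radius T * (2 * numerical_radius T - opnorm T) <=
    2 * opnorm (T \o T).
Proof.
have hTT := bounded_operator_square hT.
set a := opnorm T; set s := opnorm (T \o T); set lam := 2 * numerical_radius T.
move=> a_lt.
have a_ge0 : 0 <= a by exact: opnorm_ge0.
have s_ge0 : 0 <= s by exact: (@opnorm_ge0 _ _ (T \o T)).
have lam_gt0 : 0 < lam by lra.
apply/ler_addgt0Pr => e e_gt0.
pose eta := e / (lam + a).
have eta_gt0 : 0 < eta by rewrite divr_gt0 //; lra.
have -> : e = (lam + a) * eta by rewrite mulrC divfK // gt_eqF //; lra.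
pose A :=
  [set complex.Re `|inner H (T x) x| | x in [set x : H | `|x| = 1]]%classic.
have supA : has_sup A.
  split; last exact: numerical_radius_has_ubound.
  apply/set0P/eqP => A0; move: lam_gt0.
  by rewrite /lam /numerical_radius -/A A0 sup0 mulr0 ltxx.
(* The tolerance for which a near maximizer meets the hypothesis of
   [weak_eigenvector_of_near_maximizer] with error [eta]. *)
have tol_gt0 : 0 < eta ^+ 2 / (4 * lam).
  by rewrite divr_gt0 ?exprn_gt0 // mulr_gt0.
have [_ [x x1 <-]] := sup_adherent tol_gt0 supA.
rewrite -/(numerical_radius T) => xnear; rewrite /= in x1.
have rx1 : rnorm x = 1 by rewrite /rnorm x1.
(* Rotating [T] makes [inner H (T x) x] equal to its own modulus and changes
   neither the norms nor the moduli that occur in the estimates. *)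
have [c c1 cx] := unimodular_phase (inner H (T x) x).
pose T' : {linear H -> H} := c \*: T.
have T'E y : rnorm (T' y) = rnorm (T y) by rewrite /T' /= rnormZ c1 mul1r.
have T'_dot y : `|2 * rdot (T' y) y| <= lam * rnorm y ^+ 2.
  rewrite normrM ger0_norm // /lam -mulrA ler_pM2l //.
  apply: le_trans (modulus_le_numerical_radius hT y).
  rewrite -lecR RRe_real ?normr_real //; apply: le_trans (normc_ge_Re _) _.
  by rewrite /T' /= linearZl_LR normrM c1 mul1r.
have T'x : rdot (T' x) x = complex.Re `|inner H (T x) x|.
  by rewrite /rdot /T' /= linearZl_LR /= cx.
apply: (@approx_eigenvalue_le _ _ T' a s lam eta x) => //; first exact: ltW.
- by move=> y; rewrite T'E rnorm_le_opnorm.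
- move=> y; rewrite T'E /T' /= linearZ rnormZ c1 mul1r.
  exact: (@rnorm_le_opnorm _ _ (T \o T)).
apply: weak_eigenvector_of_near_maximizer => //; first exact: ltW.
rewrite rx1 expr1n mulr1 T'x.
have lam4_gt0 : 0 < 4 * lam by rewrite mulr_gt0.
have := ler_wpM2l (ltW lam4_gt0) (ltW xnear).
rewrite mulrBr mulrC [X in _ - X]mulrC divfK ?lt0r_neq0 // /lam; lra.
Qed.

(** If [lam > a + b] with [b <= a] and [b ^+ 2] the norm of the square, then
    [lam * (lam - a) > (a + b) * b >= 2 * b ^+ 2], against the quadratic
    inequality. *)
Lemma double_numerical_radius_le (R : realType) (H : hilbertType R)
    (T : {linear H -> H}) (hT : bounded_operator T) :
  2 * numerical_radius T <= opnorm T + Num.sqrt (opnorm (T \o T)).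
Proof.
have s_ge0 : 0 <= opnorm (T \o T).
  exact: (opnorm_ge0 (T := T \o T) (bounded_operator_square hT)).
have a_ge0 := opnorm_ge0 hT.
have b_ge0 := sqrtr_ge0 (opnorm (T \o T)).
have b_le_a : Num.sqrt (opnorm (T \o T)) <= opnorm T.
  by rewrite -ler_sqr ?nnegrE // sqr_sqrtr // opnorm_square_le.
rewrite leNgt; apply/negP => lam_gt.
have a_lt : opnorm T < 2 * numerical_radius T by lra.
have := double_numerical_radius_quadratic hT a_lt.
have bb := sqr_sqrtr s_ge0.
set b := Num.sqrt _ in b_ge0 b_le_a lam_gt bb *; nra.
Qed.

Unset Implicit Arguments.

Theorem theorem2p8 (R : realType) (H : hilbertType R) (T : {linear H -> H})
    (hT : bounded_operator T) :
  numerical_radius T ^+ 2 <=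
    2^-1 * opnorm T * Num.sqrt (opnorm (T \o T))
    + 4^-1 * opnorm (T \o T) + 4^-1 * opnorm T ^+ 2.
Proof.
have w_le := double_numerical_radius_le hT.
have s_ge0 : 0 <= opnorm (T \o T).
  exact: (opnorm_ge0 (T := T \o T) (bounded_operator_square hT)).
have b_ge0 := sqrtr_ge0 (opnorm (T \o T)).
have w_ge0 := numerical_radius_ge0 hT.
(* The right-hand side is the square of half the sum of the operator norm and
   [b]. *)
rewrite -{2}(sqr_sqrtr s_ge0).
set b := Num.sqrt _ in w_le b_ge0 *; nra.
Qed.
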